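(* Let $X$ be a finite nonempty set, let $\mathcal D\subseteq 2^X$ contain $\emptyset$ and $X$, and let $\nu\colon\mathcal D\to[0,1]$ be a partial capacity. Then $\nu$ admits a normalized capacity extension to $2^X$. The least and greatest normalized capacity extensions of $\nu$ (pointwise order) are, respectively, $$\nu_*(A):=\max\{\nu(B):B\in\mathcal D,\ B\subseteq A\},\qquad \nu^*(A):=\min\{\nu(C):C\in\mathcal D,\ A\subseteq C\},\qquad A\subseteq X.$$ Every normalized capacity $\mu$ on $X$ extending $\nu$ satisfies $$\nu_*(A)\le\mu(A)\le\nu^*(A),\qquad A\subseteq X.$$ Consequently, the normalized capacity extension of $\nu$ is unique if and only if $\nu_*=\nu^*$.
   Context: A normalized capacity on a finite set $X$ is a map $\mu\colon 2^X\to[0,1]$ with $\mu(\emptyset)=0$, $\mu(X)=1$, and $\mu(A)\le\mu(B)$ whenever $A\subseteq B\subseteq X$. A partial capacity on $\mathcal D$ (where $\emptyset,X\in\mathcal D\subseteq 2^X$) is a map $\nu\colon\mathcal D\to[0,1]$ with $\nu(\emptyset)=0$, $\nu(X)=1$, and $\nu(A)\le\nu(B)$ whenever $A,B\in\mathcal D$ and $A\subseteq B$. A normalized capacity $\mu$ extends $\nu$ if $\mu(B)=\nu(B)$ for all $B\in\mathcal D$. *)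

(* Defs.v *)
From HB Require Import structures.
From mathcomp Require Import all_boot all_order all_algebra.
From mathcomp Require Import reals.
Set Implicit Arguments.
Unset Strict Implicit.
Unset Printing Implicit Defensive.
Import Order.TTheory GRing.Theory Num.Theory.
Local Open Scope ring_scope.

Section Capacities.
Variables (R : realType) (X : finType).

Definition normalized_capacity (mu : {ffun {set X} -> R}) : Prop :=
  [/\ forall A, 0 <= mu A <= 1,
      mu set0 = 0,
      mu setT = 1
    & forall A B : {set X}, A \subset B -> mu A <= mu B].

(* A map on D is encoded by a total function nu whose values outside D are
   arbitrary: neither this predicate nor the definitions below read them when
   set0 and setT belong to D. *)
Definition partial_capacity (D : {set {set X}}) (nu : {set X} -> R) : Prop :=
  [/\ {in D, forall A, 0 <= nu A <= 1},
      nu set0 = 0,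
      nu setT = 1
    & {in D &, forall A B : {set X}, A \subset B -> nu A <= nu B}].

Definition capacity_extension (D : {set {set X}}) (nu : {set X} -> R)
    (mu : {ffun {set X} -> R}) : Prop :=
  normalized_capacity mu /\ {in D, forall B, mu B = nu B}.

Definition least_capacity_extension (D : {set {set X}}) (nu : {set X} -> R)
    (mu : {ffun {set X} -> R}) : Prop :=
  capacity_extension D nu mu
  /\ forall mu', capacity_extension D nu mu' -> forall A, mu A <= mu' A.

Definition greatest_capacity_extension (D : {set {set X}}) (nu : {set X} -> R)
    (mu : {ffun {set X} -> R}) : Prop :=
  capacity_extension D nu mu
  /\ forall mu', capacity_extension D nu mu' -> forall A, mu' A <= mu A.

(* The default value of the iterated maximum (resp. minimum) is itself one of
   the values ranged over as soon as set0 (resp. setT) belongs to D, so these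
   are the genuine maximum and minimum of the nonempty families. *)
Definition lower_envelope (D : {set {set X}}) (nu : {set X} -> R) :
    {ffun {set X} -> R} :=
  [ffun A : {set X} => \big[Num.max/nu set0]_(B in D | B \subset A) nu B].

Definition upper_envelope (D : {set {set X}}) (nu : {set X} -> R) :
    {ffun {set X} -> R} :=
  [ffun A : {set X} => \big[Num.min/nu setT]_(C in D | A \subset C) nu C].

End Capacities.

(* Main.v *)
(* A monotone map that agrees with nu on D is automatically a normalized
   capacity, because set0 and setT belong to D and bound every set; so only
   monotonicity and agreement on D have to be checked for the two envelopes. *)

Require Import Defs.
From mathcomp Require Import all_boot all_order all_algebra.
From mathcomp Require Import reals.
Import Order.TTheory GRing.Theory Num.Theory.
Local Open Scope ring_scope.

Section Envelopes.
Variables (R : realType) (X : finType) (D : {set {set X}}) (nu : {set X} -> R).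
Hypotheses (hD0 : set0 \in D) (hDT : [set: X] \in D).

Lemma le_lower_envelope (A B : {set X}) :
  B \in D -> B \subset A -> nu B <= lower_envelope D nu A.
Proof.
by move=> BD BA; rewrite ffunE; apply: (le_bigmax_cond _ nu); rewrite BD.
Qed.

Lemma lower_envelope_le (A : {set X}) (c : R) :
  (forall B : {set X}, B \in D -> B \subset A -> nu B <= c) ->
  lower_envelope D nu A <= c.
Proof.
move=> h; rewrite ffunE; apply: bigmax_le => [|B /andP[]]; last exact: h.
(* The default value [nu set0] also obeys the bound, since [set0] is a member of [D] inside [A]. *)
by apply: h; rewrite ?sub0set.
Qed.

Lemma upper_envelope_le (A C : {set X}) :
  C \in D -> A \subset C -> upper_envelope D nu A <= nu C.
Proof.
by move=> CD AC; rewrite ffunE; apply: (bigmin_le_cond _ nu); rewrite CD.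
Qed.

Lemma le_upper_envelope (A : {set X}) (c : R) :
  (forall C : {set X}, C \in D -> A \subset C -> c <= nu C) ->
  c <= upper_envelope D nu A.
Proof.
move=> h; rewrite ffunE; apply: le_bigmin => [|C /andP[]]; last exact: h.
by apply: h; rewrite ?subsetT.
Qed.

(** For [B] and [C] in [D] with [B] inside [A] and [A] inside [C], monotonicity of [mu] gives
    [nu B = mu B <= mu A <= mu C = nu C]; then optimize over [B] and [C]. *)
Lemma extension_envelope_bounds (mu : {ffun {set X} -> R}) :
  capacity_extension D nu mu ->
  forall A, lower_envelope D nu A <= mu A <= upper_envelope D nu A.
Proof.
move=> [[_ _ _ mono] ext] A; apply/andP; split.
  by apply: lower_envelope_le => B BD BA; rewrite -ext ?mono.
by apply: le_upper_envelope => C CD AC; rewrite -ext ?mono.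
Qed.

Hypothesis hnu : partial_capacity D nu.

Lemma monotone_extension (mu : {ffun {set X} -> R}) :
  {homo mu : A B / A \subset B >-> A <= B} ->
  {in D, forall B, mu B = nu B} -> capacity_extension D nu mu.
Proof.
have [_ nu0 nuT _] := hnu => mono ext; split=> //.
have mu0 : mu set0 = 0 by rewrite ext.
have muT : mu setT = 1 by rewrite ext.
(* Reading 0 and 1 as [mu set0] and [mu setT] turns the range condition into two instances of
   monotonicity. *)
by split=> // A; rewrite -mu0 -muT !mono ?sub0set ?subsetT.
Qed.

(** Enlarging [A] enlarges the family under the maximum. When [B] is in [D], it is the largest
    member of its own family, so the maximum is [nu B]. *)
Lemma lower_envelope_extension : capacity_extension D nu (lower_envelope D nu).
Proof.
have [_ _ _ mono] := hnu; apply: monotone_extension => [A B AB | B BD].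
  apply: lower_envelope_le => C CD CA.
  exact: le_lower_envelope (subset_trans CA AB).
apply/le_anti; rewrite le_lower_envelope // andbT.
by apply: lower_envelope_le => C CD; apply: mono.
Qed.

(** Dually, enlarging [A] shrinks the family under the minimum, and a member of [D] is the smallest
    of its own supersets. *)
Lemma upper_envelope_extension : capacity_extension D nu (upper_envelope D nu).
Proof.
have [_ _ _ mono] := hnu; apply: monotone_extension => [A B AB | B BD].
  apply: le_upper_envelope => C CD BC.
  exact: upper_envelope_le (subset_trans AB BC).
apply/le_anti; rewrite upper_envelope_le //=.
by apply: le_upper_envelope => C CD; apply: mono.
Qed.

End Envelopes.

Theorem theorem5p2 (R : realType) (X : finType) (hX : (0 < #|X|)%N)
    (D : {set {set X}}) (hD0 : set0 \in D) (hDT : [set: X] \in D)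
    (nu : {set X} -> R) (hnu : partial_capacity D nu) :
  [/\ exists mu : {ffun {set X} -> R}, capacity_extension D nu mu,
      least_capacity_extension D nu (lower_envelope D nu),
      greatest_capacity_extension D nu (upper_envelope D nu),
      forall mu : {ffun {set X} -> R}, capacity_extension D nu mu ->
        forall A : {set X},
          lower_envelope D nu A <= mu A <= upper_envelope D nu A
    & (exists! mu : {ffun {set X} -> R}, capacity_extension D nu mu) <->
      lower_envelope D nu = upper_envelope D nu].
Proof.
have lowP := lower_envelope_extension _ _ _ _ hD0 hDT hnu.
have uppP := upper_envelope_extension _ _ _ _ hD0 hDT hnu.
have bounds := extension_envelope_bounds _ _ _ nu hD0 hDT.
split=> //.
- by exists (lower_envelope D nu).
- by split=> // mu /bounds + A => /(_ A)/andP[].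
- by split=> // mu /bounds + A => /(_ A)/andP[].
split=> [[mu [_ uniq]] | low_upp].
  (* Both envelopes are extensions, so each equals the unique one. *)
  by rewrite -(uniq _ lowP) -(uniq _ uppP).
(* Conversely, coinciding envelopes squeeze every extension onto their common value. *)
exists (lower_envelope D nu); split=> // mu /bounds mu_bounds.
by apply/ffunP => A; move: (mu_bounds A); rewrite -low_upp => /le_anti.
Qed.
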